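(* For infinitely many positive integers $n$ there exists a path-pairable graph $G$ on $n$ vertices with maximum degree $\Delta(G)=\sqrt{n}$.
   Context: Graphs are finite, simple and undirected. For a positive integer $k$, a graph $G$ on at least $2k$ vertices is called $k$-path-pairable if, for any pair of disjoint sets of pairwise different vertices $X=\{x_1,\dots,x_k\}$ and $Y=\{y_1,\dots,y_k\}$ of $G$ (so $x_1,\dots,x_k,y_1,\dots,y_k$ are $2k$ distinct vertices), there exist $k$ pairwise edge-disjoint paths $P_1,\dots,P_k$ in $G$ such that $P_i$ joins $x_i$ to $y_i$. A graph on exactly $2k$ vertices is called path-pairable if it is $k$-path-pairable. *)

(* Defs.v *)
From mathcomp Require Import all_boot all_order all_algebra.

Set Implicit Arguments.
Unset Strict Implicit.
Unset Printing Implicit Defensive.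

Record sgraph := SGraph {
  vertex :> finType;
  adj : rel vertex;
  adj_sym : symmetric adj;
  adj_irrefl : irreflexive adj }.

Definition degree (G : sgraph) (u : G) : nat := #|[set v | adj u v]|.

Definition max_degree (G : sgraph) : nat := \max_(u : G) degree u.

(* As in path.v, a path is given by its first vertex x and the sequence p of
   the vertices that follow; uniq makes it a path rather than a walk. *)
Definition joins (G : sgraph) (x y : G) (p : seq G) : bool :=
  [&& path (@adj G) x p, last x p == y & uniq (x :: p)].

(* Edges are unordered pairs {u, v}, so that two paths using the same edge in
   opposite directions are not edge-disjoint. *)
Definition path_edges (G : sgraph) (x : G) (p : seq G) : seq {set G} :=
  [seq [set e.1; e.2] | e <- zip (x :: p) p].

Definition k_path_pairable (k : nat) (G : sgraph) : Prop :=
  [/\ 0 < k, k.*2 <= #|G|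
    & forall x y : 'I_k -> G,
        injective x -> injective y -> (forall i j, x i != y j) ->
        exists P : 'I_k -> seq G,
          (forall i, joins (x i) (y i) (P i)) /\
          (forall i j, i != j ->
             [disjoint path_edges (x i) (P i) & path_edges (x j) (P j)])].

Definition path_pairable (G : sgraph) : Prop :=
  exists2 k, #|G| = k.*2 & k_path_pairable k G.

(* Main.v *)
Require Import Defs.
From mathcomp Require Import all_boot all_order all_algebra.
From mathcomp Require Import zify.

(** A path-pairable graph whose maximum degree is at most the square root of its
order [n = m ^ 2] is enough: while the maximum degree is below [m], an extra
edge at a vertex of maximum degree raises it by exactly one, and extra edges
never destroy a linkage ([exact_max_degree]).

The graph is a folded five-stage Clos network.  Every vertex [z], whatever its
role, is joined to a home hub (a hub is its own home); hubs come in groups, and for each colour [c] a group [g]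
owns a gate [(c, g)], adjacent to all hubs of [g] and to all cores [(c, d)].
A pair of terminals receives two colours [c] and [d], and both of its ends
climb towards the same core:
  [z] -> home hub of [z] -> gate [(c, group of that hub)] -> core [(c, d)].
Two pairs could only collide on an edge of the same level: on the second level
if they share a hub and the colour [c], on the third if they share a gate and
the colour [d].  Both are excluded by greedy colouring ([separate_above], used
twice): a hub is the home of at most [T] vertices, so [c] has to avoid at most
[2T] values; once [c] is fixed, each hub serves at most one pair for each colour,
so a gate sees at most [a] pairs, [a] being the size of a group, and [d] has
to avoid at most [2a] values.  This gives [clos_route].

The degrees are of order [T + #colours], [a + #colours] and the number of
groups, while about [T * a * #groups] vertices can be housed.  With [T = a = s],
[3s] colours of each kind and a constant number 32 of groups, all degrees are at
most [5s] while there is room for [32 s ^ 2 > (5s) ^ 2] vertices; leaves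
complete the order to [(5s) ^ 2] ([low_degree_path_pairable]). *)

Set Implicit Arguments.
Unset Strict Implicit.
Unset Printing Implicit Defensive.

(** * Colouring the pairs *)

Lemma greedy_coloring (I C : finType) (r : rel I) :
  symmetric r -> (forall i, #|[set j | r i j]| < #|C|) ->
  exists f : I -> C, forall i j, i != j -> r i j -> f i != f j.
Proof.
move=> r_sym few; case: (pickP (mem I)) => [i0 _|noI]; last first.
  have noC : I -> C by move=> i; have := noI i.
  by exists noC => i; have := noI i.
have /card_gt0P[c0 _] : 0 < #|C| by apply: leq_ltn_trans (few i0).
suff [f fP]: exists f : I -> C,
    {in enum I &, forall i j, i != j -> r i j -> f i != f j}.
  by exists f => i j; apply: fP; rewrite mem_enum.
elim: (enum I) => [|x s [f fP]]; first by exists (fun=> c0).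
have [c cP]: exists c, c \notin f @: [set j | r x j].
  apply/existsP; rewrite -negb_forall; apply/negP => /forallP allC.
  have: #|C| <= #|f @: [set j | r x j]|.
    by apply/subset_leq_card/subsetP => c _; apply: allC.
  by rewrite leqNgt (leq_ltn_trans (leq_imset_card _ _) (few x)).
have cN j : r x j -> c != f j.
  by move=> rxj; apply: contraNneq cP => ->; apply: imset_f; rewrite inE.
exists (fun j => if j == x then c else f j) => i j.
rewrite !inE; have [->|ix] := eqVneq i x; have [->|jx] := eqVneq j x => //=.
- by move=> _ _ _; apply: cN.
- by move=> _ _ _; rewrite r_sym eq_sym; apply: cN.
- exact: fP.
Qed.

Lemma card_setU_le (T : finType) (A B : {set T}) p q :
  #|A| <= p -> #|B| <= q -> #|A :|: B| <= p + q.
Proof.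
by move=> leAp leBq; apply: leq_trans (leq_card_setU A B) (leq_add leAp leBq).
Qed.

(** Pair [i] visits the sites [e i true] and [e i false]; no site is visited by
two pairs, but the two ends of one pair may meet. *)
Definition separated (I S : Type) (e : I -> bool -> S) : Prop :=
  forall i j b b', e i b = e j b' -> i = j.

(** Moving along [up] merges sites, but at most [K] at a time: each of the two
ends of a pair meets at most [K] pairs, one for each site below, and a greedy
colouring tells them apart. *)
Lemma separate_above (I S0 S C : finType) (e : I -> bool -> S0)
    (up : S0 -> S) (K : nat) :
  separated e -> (forall s, #|[set u | up u == s]| <= K) -> K.*2 < #|C| ->
  exists c : I -> C, separated (fun i b => (c i, up (e i b))).
Proof.
move=> sep fibre ltC.
pose meet i j := [exists b, exists b', up (e i b) == up (e j b')].
have meetP i j : reflect (exists b b', up (e i b) = up (e j b')) (meet i j).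
  apply: (iffP existsP) => -[b]; first by case/existsP=> b' /eqP; exists b, b'.
  by case=> b' Eb; exists b; apply/existsP; exists b'; apply/eqP.
pose at_site s := [set j | [exists b', up (e j b') == s]].
have card_at s : #|at_site s| <= K.
  apply: leq_trans (fibre s).
  (* by separation, a site below belongs to at most one pair *)
  pose owner u := [pick j | [exists b', e j b' == u]].
  have Some_inj : injective (@Some I) by move=> ? ? [].
  rewrite -(card_imset (mem (at_site s)) Some_inj).
  apply: leq_trans (leq_imset_card owner _).
  apply/subset_leq_card/subsetP => _ /imsetP[j + ->].
  rewrite inE => /existsP[b' Es]; apply/imsetP; exists (e j b').
    by rewrite inE.
  rewrite /owner; case: pickP => [j' /existsP[b /eqP/sep->] //|/(_ j)].
  by case/existsP; exists b'.
have [| i | c cP] := @greedy_coloring I C meet.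
- by move=> i j; apply/meetP/meetP => -[b [b' Eb]]; exists b', b.
- apply: leq_ltn_trans ltC; rewrite -addnn.
  apply: leq_trans (leq_add (card_at (up (e i true))) (card_at (up (e i false)))).
  apply: leq_trans (leq_card_setU _ _).
  apply/subset_leq_card/subsetP => j.
  rewrite !inE => /meetP[[] [b' Eb]]; apply/orP; [left|right];
    by apply/existsP; exists b'; rewrite Eb.
exists c => i j b b' [Ec Es]; apply: contraTeq isT => neq_ij.
have meet_ij : meet i j by apply/meetP; exists b, b'.
by have := cP i j neq_ij meet_ij; rewrite Ec eqxx.
Qed.

(** An injection of [V] into [K] copies of [H] is a distribution in which no
element of [H] receives more than [K] elements. *)
Lemma balanced_map (V H : finType) (K : nat) :
  #|V| <= K * #|H| ->
  exists f : V -> H, forall h, #|[set z | f z == h]| <= K.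
Proof.
rewrite -{1}(card_ord K) -card_prod => leVW.
pose phi (z : V) : 'I_K * H := enum_val (widen_ord leVW (enum_rank z)).
have phi_inj : injective phi.
  by move=> z z' /enum_val_inj/(congr1 val)/= /val_inj/enum_rank_inj.
exists (fun z => (phi z).2) => h.
rewrite -[leqRHS]card_ord -(@card_in_imset _ _ (fun z => (phi z).1)) ?max_card //.
move=> z z'; rewrite !inE => /eqP z2 /eqP z'2 Ez.
apply: phi_inj; move: z2 z'2 Ez.
by case: (phi z) (phi z') => [t v] [t' v'] /= -> -> ->.
Qed.

(** * From reserved edges to edge-disjoint paths *)

Lemma path_zip (T : eqType) (e : rel T) x p :
  path e x p -> forall s, s \in zip (x :: p) p -> e s.1 s.2.
Proof.
elim: p x => //= y p IHp x /andP[exy ep] s.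
by rewrite inE => /predU1P[-> //|]; apply: IHp.
Qed.

(** It suffices to reserve disjoint sets of edges, one connecting each pair: a
walk inside such a set can be shortened to a path without leaving it. *)
Lemma disjoint_routing (G : sgraph) (k : nat) (x y : 'I_k -> G)
    (e : 'I_k -> rel G) :
  (forall i, subrel (e i) (@adj G)) -> (forall i, symmetric (e i)) ->
  (forall i j u w, e i u w -> e j u w -> i = j) ->
  (forall i, connect (e i) (x i) (y i)) ->
  exists P : 'I_k -> seq G,
    (forall i, joins (x i) (y i) (P i)) /\
    (forall i j, i != j ->
       [disjoint path_edges (x i) (P i) & path_edges (x j) (P j)]).
Proof.
move=> e_adj e_sym e_disj e_conn.
have exP i : exists p, [&& path (e i) (x i) p, last (x i) p == y i
                         & uniq (x i :: p)].
  have /connectP[p ep ->] := e_conn i.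
  by case/shortenP: ep => p' ep' up' _; exists p'; rewrite ep' up' eqxx.
pose P i := xchoose (exP i); exists P; split=> [i|i j neq_ij].
  have /and3P[ep lp up] := xchooseP (exP i).
  by rewrite /joins lp up (sub_path (e_adj i) ep).
apply/pred0Pn => -[_ /andP[/mapP[[u w] uw ->] /mapP[[u' w'] uw' Es]]].
have /and3P[/path_zip/(_ _ uw)/= ei _ _] := xchooseP (exP i).
have /and3P[/path_zip/(_ _ uw')/= ej _ _] := xchooseP (exP j).
case/eqP: neq_ij; apply: (e_disj _ _ u w) => //.
have neq_uw' : u' != w'.
  by apply: contraTneq (e_adj _ _ _ ej) => ->; rewrite adj_irrefl.
have neq_uw : u != w.
  by apply: contraTneq (e_adj _ _ _ ei) => ->; rewrite adj_irrefl.
move/setP: Es => Es; have := Es u; have := Es w; rewrite !inE !eqxx orbT /=.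
move=> /esym/orP[]/eqP Ew /esym/orP[]/eqP Eu; move: neq_uw; rewrite Ew Eu ?eqxx //.
by rewrite e_sym.
Qed.

(** * The folded Clos network *)

Section FoldedClos.

Variables (H Gp C D L : finType) (grp : H -> Gp).

(** Hubs, gates, cores and leaves, in this order. *)
Definition node : finType := (H + (C * Gp + (C * D + L)))%type.

Definition hub v : node := inl v.
Definition gate c g : node := inr (inl (c, g)).
Definition core c d : node := inr (inr (inl (c, d))).

Variable home : node -> H.
Hypothesis home_hub : forall v, home (hub v) = v.
(* A gate living on a hub of its own group would use one edge both to reach its
   home and to carry the traffic of that hub. *)
Hypothesis home_gate : forall c g, grp (home (gate c g)) != g.

Definition arc (u w : node) : bool :=
  (w == hub (home u)) ||
  match u, w with
  | inl v, inr (inl (_, g)) => grp v == g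
  | inr (inl (c, _)), inr (inr (inl (c', _))) => c == c'
  | _, _ => false
  end.

(** The loop from a hub to its own home disappears here. *)
Definition link (u w : node) : bool := (u != w) && (arc u w || arc w u).

Lemma link_sym : symmetric link.
Proof. by move=> u w; rewrite /link eq_sym orbC. Qed.

Lemma link_irrefl : irreflexive link.
Proof. by move=> u; rewrite /link eqxx. Qed.

Definition clos : sgraph := SGraph link_sym link_irrefl.

Definition climb (c : C) (d : D) (z : node) : seq (node * node) :=
  let v := home z in
  [:: (z, hub v); (hub v, gate c (grp v)); (gate c (grp v), core c d)].

Lemma climb_arc c d z u w : (u, w) \in climb c d z -> arc u w.
Proof.
by rewrite !inE => /or3P[]/eqP[-> ->]; rewrite /arc /= eqxx ?orbT.
Qed.

(** The edge on level 1, 2 or 3 of a climb determines the vertex, the pair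
(colour, hub), or the triple (colours, group) it starts from.  Edges of
different levels differ because of the roles of their ends, except that a
home edge could run between a gate and a hub of its group; this is what
[home_gate] forbids. *)
Lemma climb_disjoint c d z c' d' z' u w : u != w ->
  (u, w) \in climb c d z ->
  ((u, w) \in climb c' d' z') || ((w, u) \in climb c' d' z') ->
  [\/ z = z', (c, home z) = (c', home z')
    | (d, (c, grp (home z))) = (d', (c', grp (home z')))].
Proof.
move=> neq; rewrite !inE => /or3P[]/eqP[Eu Ew]; subst u w.
- case/orP=> /or3P[]/eqP[].
  + by move=> ->; constructor 1.
  + by [].
  + by [].
  (* two home edges in opposite directions: both ends are hubs, so it is a loop *)
  + move=> /esym Ez' /esym Ez; move: neq.
    by rewrite -{1}Ez Ez' -[in home z]Ez home_hub eqxx.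
  + by move=> Ev Ez; move: (home_gate c' (grp (home z'))); rewrite -Ez Ev eqxx.
  + by [].
- case/orP=> /or3P[]/eqP[].
  + by [].
  + by move=> -> -> _; constructor 2.
  + by [].
  + by move=> Ez' Ev; move: (home_gate c (grp (home z))); rewrite Ez' -Ev eqxx.
  + by [].
  + by [].
- case/orP=> /or3P[]/eqP[] //.
  by move=> -> -> _ ->; constructor 3.
Qed.

(** The sites are the vertices themselves, then the pairs (colour, hub), then
the gates with the second colour. *)
Lemma clos_route k (x y : 'I_k -> node) T a :
  injective x -> injective y -> (forall i j, x i != y j) ->
  (forall v, #|[set z | home z == v]| <= T) -> T.*2 < #|C| ->
  (forall g, #|[set v | grp v == g]| <= a) -> a.*2 < #|D| ->
  exists P : 'I_k -> seq clos,
    (forall i, @joins clos (x i) (y i) (P i)) /\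
    (forall i j, i != j ->
       [disjoint @path_edges clos (x i) (P i) & @path_edges clos (x j) (P j)]).
Proof.
move=> x_inj y_inj neq_xy load ltC size_grp ltD.
pose z i (b : bool) := if b then y i else x i.
have sep0 : separated z.
  move=> i j [] []; rewrite /z; [exact: y_inj| | |exact: x_inj].
    by move=> E; move: (neq_xy j i); rewrite E eqxx.
  by move=> E; move: (neq_xy i j); rewrite E eqxx.
have [c sep1] := separate_above sep0 load ltC.
have size_fibre (s : C * Gp) :
    #|[set u : C * H | (u.1, grp u.2) == s]| <= a.
  apply: leq_trans (size_grp s.2).
  rewrite -(@card_in_imset _ _ snd).
    apply/subset_leq_card/subsetP => _ /imsetP[u + ->].
    by rewrite !inE => /eqP <- /=.
  move=> [c1 v1] [c2 v2]; rewrite !inE => /eqP/= <- /eqP[-> _] /= ->.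
  by [].
have [d sep2] := separate_above sep1 size_fibre ltD.
(* the edges reserved for pair i: the climbs of its two ends *)
pose e i (u w : node) := (u != w) &&
  [exists b, ((u, w) \in climb (c i) (d i) (z i b))
          || ((w, u) \in climb (c i) (d i) (z i b))].
apply: (@disjoint_routing clos _ _ _ e) => [i u w|i u w|i j u w|i].
- case/andP=> neq /existsP[b uw]; rewrite /= /link neq /=.
  by case/orP: uw => /climb_arc->; rewrite ?orbT.
- by rewrite /e eq_sym; congr (_ && _); apply: eq_existsb => b; rewrite orbC.
- case/andP=> neq /existsP[b uwi] /andP[_ /existsP[b' uwj]].
  suff [||] : [\/ z i b = z j b', (c i, home (z i b)) = (c j, home (z j b'))
    | (d i, (c i, grp (home (z i b)))) = (d j, (c j, grp (home (z j b'))))].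
  + exact: sep0.
  + exact: sep1.
  + exact: sep2.
  case/orP: uwi => uwi; first exact: climb_disjoint neq uwi uwj.
  by apply: climb_disjoint uwi _; [rewrite eq_sym | rewrite orbC].
- have e_sym : symmetric (e i).
    move=> u w; rewrite /e eq_sym; congr (_ && _).
    by apply: eq_existsb => b; rewrite orbC.
  have step b u w : (u, w) \in climb (c i) (d i) (z i b) -> connect (e i) u w.
    move=> uw; have [-> //|neq] := eqVneq u w.
    by apply: connect1; rewrite /e neq; apply/existsP; exists b; rewrite uw.
  have to_core b : connect (e i) (z i b) (core (c i) (d i)).
    set v := home (z i b).
    apply: connect_trans (step b _ (hub v) _) _; first exact: mem_head.
    apply: connect_trans (step b _ (gate (c i) (grp v)) _) (step b _ _ _);
      by rewrite !inE eqxx ?orbT.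
  apply: connect_trans (to_core false) _.
  by rewrite (sym_connect_sym e_sym) (to_core true).
Qed.

Lemma clos_max_degree m T a :
  (forall v, #|[set z | home z == v]| <= T) ->
  (forall g, #|[set v | grp v == g]| <= a) ->
  T + #|C| <= m -> a + #|D| < m -> #|Gp| < m -> max_degree clos <= m.
Proof.
move=> load size_grp hub_m gate_m core_m; apply/bigmax_leqP => u _.
have hubE v : home (inl v) = v by exact: home_hub.
suff [A [leAm subA]]: exists A : {set node}, #|A| <= m /\
    forall w, w != u -> arc u w || arc w u -> w \in A.
  apply: leq_trans leAm; apply/subset_leq_card/subsetP => w.
  by rewrite inE => /andP[neq]; apply: subA; rewrite eq_sym.
case: u => [v|[[c g]|[[c d]|l]]].
- exists ([set z | home z == v] :|: (gate^~ (grp v)) @: [set: C]); split.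
    apply: leq_trans hub_m; apply: card_setU_le => //.
    by rewrite -cardsT leq_imset_card.
  case=> [v'|[[c g]|[[c d]|l]]] neq; rewrite !inE /= /arc /= ?orbF.
  + by rewrite !hubE => /orP[]/eqP[->]; rewrite eqxx.
  + case/orP=> [/eqP<-|/eqP[->]]; last by rewrite eqxx.
    by rewrite orbC (imset_f (gate^~ _)).
  + by move=> /eqP[->]; rewrite eqxx.
  + by move=> /eqP[->]; rewrite eqxx.
- exists ([set hub (home (gate c g))] :|:
    (hub @: [set v | grp v == g] :|: (core c) @: [set: D])); split.
    apply: leq_trans gate_m; rewrite -add1n.
    apply: card_setU_le; first by rewrite cards1.
    apply: card_setU_le; first exact: leq_trans (leq_imset_card _ _) (size_grp g).
    by rewrite -cardsT leq_imset_card.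
  case=> [v|[[c' g']|[[c' d]|l]]] neq; rewrite !inE /= /arc /= ?orbF.
  + by case/orP=> [-> //|Eg]; rewrite (imset_f hub) ?inE ?Eg ?orbT.
  + by [].
  + by move=> /eqP->; rewrite (imset_f (core c')) ?orbT.
  + by [].
- exists ([set hub (home (core c d))] :|: (gate c) @: [set: Gp]); split.
    apply: leq_trans core_m; rewrite -add1n.
    apply: card_setU_le; first by rewrite cards1.
    by rewrite -cardsT leq_imset_card.
  case=> [v|[[c' g']|[[c' d']|l]]] neq; rewrite !inE /= /arc /= ?orbF.
  + by move=> ->.
  + by move=> /eqP->; rewrite (imset_f (gate c)) ?orbT.
  + by [].
  + by [].
- exists [set hub (home (inr (inr (inr l))))]; split.
    by rewrite cards1 (leq_ltn_trans _ core_m).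
  by case=> [v|[[c' g']|[[c' d']|l']]] neq; rewrite !inE /= /arc /= ?orbF.
Qed.

End FoldedClos.

(** * Reaching the maximum degree exactly *)

(** An edge added at a vertex of maximum degree raises the maximum degree by
exactly one, since each degree grows by at most one. *)
Lemma exact_max_degree (G : sgraph) (m : nat) :
  max_degree G <= m -> m < #|G| ->
  exists G' : sgraph,
    [/\ #|G'| = #|G|, max_degree G' = m & path_pairable G -> path_pairable G'].
Proof.
move: {2}(m - _) (erefl (m - max_degree G)) => j.
elim: j G => [|j IHj] G Ej leGm ltmG.
  exists G; split=> //; apply/eqP; rewrite eqn_leq leGm.
  by rewrite -subn_eq0 Ej.
have ltGm : max_degree G < m by rewrite -subn_gt0 Ej.
have [u Eu] : {u : G | max_degree G = degree u}.
  by apply: eq_bigmax; apply: leq_ltn_trans ltmG.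
have [v] : exists v, v \notin u |: [set v | adj u v].
  apply/existsP; rewrite -negb_forall; apply/negP => /forallP allG.
  have: #|G| <= #|u |: [set v | adj u v]|.
    by apply/subset_leq_card/subsetP => v _; apply: allG.
  rewrite leqNgt (leq_ltn_trans (leq_card_setU _ _)) // cards1 add1n.
  by apply: leq_ltn_trans ltmG; rewrite -/(degree u) -Eu.
rewrite !inE negb_or => /andP[neq_vu uNv].
pose new : rel G := fun a b => [|| adj a b, (a == u) && (b == v)
                                  | (a == v) && (b == u)].
have new_sym : symmetric new.
  move=> a b; rewrite /new adj_sym; congr (_ || _).
  by rewrite orbC (andbC (a == u)) (andbC (a == v)).
have new_irr : irreflexive new.
  move=> a; rewrite /new adj_irrefl /=; apply/negbTE; rewrite negb_or !negb_and.
  by have [->|] := eqVneq a u; rewrite /= ?orbT // eq_sym neq_vu.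
pose G1 := SGraph new_sym new_irr.
have EG1 : max_degree G1 = (max_degree G).+1.
  apply/eqP; rewrite eqn_leq; apply/andP; split.
    apply/bigmax_leqP => w _.
    have leG : #|[set b | @adj G w b]| <= max_degree G.
      exact: (@leq_bigmax _ (@degree G) w).
    pose extra : G := if w == u then v else u.
    rewrite -addn1; apply: leq_trans (card_setU_le leG (eq_leq (cards1 extra))).
    apply/subset_leq_card/subsetP => b; rewrite !inE /= /new /extra.
    case/or3P=> [->//|/andP[/eqP-> /eqP->]|/andP[/eqP-> /eqP->]].
      by rewrite !eqxx orbT.
    by rewrite (negbTE neq_vu) eqxx orbT.
  apply: leq_trans (@leq_bigmax _ (@degree G1) u); rewrite Eu /degree.
  have -> : #|[set b | adj u b]|.+1 = #|v |: [set b | adj u b]|.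
    by rewrite cardsU1 inE uNv.
  apply/subset_leq_card/subsetP => b; rewrite !inE /= /new.
  by case/orP=> [/eqP->|->//]; rewrite !eqxx orbT.
have [||G' [cG' mG' ppG']] := IHj G1 _ _ ltmG.
- by rewrite EG1; lia.
- by rewrite EG1.
exists G'; split=> // ppG; apply: ppG'.
case: ppG => k cG [k_gt0 le_k route]; exists k => //; split=> // x y xI yI neq.
have [P [Pxy Pdisj]] := route x y xI yI neq.
exists P; split=> // i; have /and3P[pP lP uP] := Pxy i.
apply/and3P; split=> //; apply: sub_path pP => a b ab.
by rewrite /= /new ab.
Qed.

(** * The choice of parameters *)

(** A hub houses itself, the gates [((x, t), g)] for three values of [t], and
at most [s - 4] cores and leaves, which is a load of at most [s]; the bound 8 on [s] leaves
room for a nonnegative number of leaves. *)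
Lemma low_degree_path_pairable (s : nat) : 8 <= s -> ~~ odd s ->
  exists G : sgraph,
    [/\ #|G| = (5 * s) ^ 2, path_pairable G & max_degree G <= 5 * s].
Proof.
move=> s_ge8 s_even.
(* groups carry a Boolean so that negating it moves a gate to another group *)
pose A := 'I_s; pose Gp : finType := (bool * 'I_16)%type.
pose H : finType := (Gp * A)%type; pose C : finType := (A * 'I_3)%type.
pose D := C; pose L := 'I_(16 * s ^ 2 - 128 * s).
have cardH : #|H| = 32 * s by rewrite !card_prod card_bool !card_ord.
have cardC : #|C| = s * 3 by rewrite card_prod !card_ord.
have cardGp : #|Gp| = 32 by rewrite card_prod card_bool card_ord.
have [f fP] : exists f : C * D + L -> H,
    forall v, #|[set w | f w == v]| <= s - 4.
  apply: balanced_map; rewrite cardH card_sum card_prod cardC card_ord.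
  by nia.
pose grp : H -> Gp := fst.
pose home (u : node H Gp C D L) : H := match u with
  | inl v => v
  | inr (inl (c, g)) => ((~~ g.1, g.2), c.1)
  | inr (inr w) => f w
  end.
have home_hub v : home (hub _ _ _ _ v) = v by [].
have home_gate c g : grp (home (gate _ _ _ c g)) != g.
  by case: g => [[] t].
have load v : #|[set z | home z == v]| <= s.
  pose near (t : 'I_3) := gate H D L (v.2, t) (~~ v.1.1, v.1.2).
  have sub : [set z | home z == v] \subset [set hub Gp C D L v] :|:
      (near @: [set: 'I_3] :|: (fun w => inr (inr w)) @: [set w | f w == v]).
    apply/subsetP => -[v'|[[[x t] [b g]]|w]]; rewrite !inE /=.
    - by move=> /eqP->; rewrite eqxx.
    - move=> /eqP Ev; apply/orP; left; apply/imsetP; exists t; first by rewrite inE.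
      by rewrite /near /gate -Ev /= negbK.
    - by move=> Ew; rewrite (imset_f (fun w => inr (inr w))) ?inE ?orbT.
  apply: leq_trans (subset_leq_card sub) _.
  apply: (@leq_trans (1 + (3 + (s - 4)))); last by lia.
  apply: card_setU_le; first by rewrite cards1.
  apply: card_setU_le; last exact: leq_trans (leq_imset_card _ _) (fP v).
  by rewrite -[leqRHS]card_ord -cardsT leq_imset_card.
have size_grp g : #|[set v | grp v == g]| <= s.
  rewrite -[leqRHS](card_ord s) -(@card_in_imset _ _ snd) ?max_card //.
  by move=> [g1 x1] [g2 x2]; rewrite !inE /= => /eqP-> /eqP-> ->.
exists (clos grp home).
have cardG : #|clos grp home| = (5 * s) ^ 2.
  rewrite /= /node !card_sum !card_prod card_bool !card_ord.
  by nia.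
split=> //.
  have Ek : (5 * s) ^ 2 = (50 * s./2 ^ 2).*2.
    by rewrite -{1}(even_halfK s_even); lia.
  exists (50 * s./2 ^ 2); first by rewrite cardG.
  split; [by nia | by rewrite cardG Ek | move=> x y x_inj y_inj neq].
  by apply: (clos_route home_hub home_gate x_inj y_inj neq load _ size_grp _);
    rewrite cardC; lia.
by apply: (clos_max_degree home_hub load size_grp); rewrite ?cardC ?cardGp; lia.
Qed.

Theorem corollary2 (R : rcfType) :
  forall N : nat, exists n : nat, (N < n)%N /\
    exists G : sgraph,
      [/\ #|G| = n,
          path_pairable G
        & ((max_degree G)%:R = Num.sqrt (n%:R) :> R)%R].
Proof.
move=> N; pose s := (N + 4).*2.
have s_even : ~~ odd s by rewrite odd_double.
have s_ge8 : 8 <= s by rewrite /s; lia.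
exists ((5 * s) ^ 2); split; first by rewrite /s; nia.
have [G [cardG ppG leG]] := low_degree_path_pairable s_ge8 s_even.
have [|G' [cardG' maxG' ppG']] := exact_max_degree leG.
  by rewrite cardG; nia.
exists G'; split; [by rewrite cardG' | exact: ppG' | rewrite maxG'].
by rewrite GRing.natrX Num.Theory.sqrtr_sqr Num.Theory.normr_nat.
Qed.
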